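(* Consider the following algorithm, with input a signed graph $G=(V,E)$: Step 1: If $V=\emptyset$, output the empty sequence $()$. Otherwise go to Step 2. Step 2: Find a vertex $v\in S(G)$ and go to Step 3. If no such vertex exists, output NULL. Step 3: Perform this algorithm recursively for input $G\setminus v$. If it outputs a sequence $(w_1,\dots,w_k)$, then output the sequence $(w_1,\dots,w_k,v)$. If it outputs NULL, then output NULL. Then $G$ is signed-eliminable if and only if the algorithm outputs a (possibly empty) sequence, not NULL. Moreover, if the output is a sequence $(v_1,\dots,v_n)$, then the map $\nu:v_i\mapsto i$ is a signed elimination ordering on $G$.
   Context: All graphs are finite, simple and undirected. A signed graph is a graph $G=(V,E)$ together with a partition $E=E_+\sqcup E_-$ (either part may be empty); put $G_\sigma=(V,E_\sigma)$ for $\sigma\in\{+,-\}$, and let $-\sigma$ be the opposite sign. $G\setminus v$ is the induced signed subgraph on $V\setminus\{v\}$. An ordering on $G$ is a bijection $\nu:V\to\{1,\dots,|V|\}$. It is a signed elimination ordering (SEO) if for every triple $(u,v,w)$ of distinct vertices with $\nu(u)<\nu(w)>\nu(v)$ and each $\sigma\in\{+,-\}$: (E1) if $uw,wv\in E_\sigma$ then $uv\in E_\sigma$; (E2) if $uv\in E_\sigma$ and $vw\in E_{-\sigma}$ then $uw\in E_\sigma$. $G$ is signed-eliminable if it admits a SEO. A vertex $v$ is signed-simplicial in $G$ if for each $\sigma\in\{+,-\}$: (S1) $N_{G_\sigma}[v]=\{v\}\cup\{w: vw\in E_\sigma\}$ is a clique in $G_\sigma$; (S2) whenever $uw\in E_{-\sigma}$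 and $wv\in E_\sigma$, then $uv\in E_{-\sigma}$. $S(G)$ denotes the set of signed-simplicial vertices of $G$. The choice of $v\in S(G)$ in Step 2 is arbitrary. *)

(* Defs.v *)
From mathcomp Require Import all_boot.

Set Implicit Arguments.
Unset Strict Implicit.
Unset Printing Implicit Defensive.

(* Signs are booleans, true being + and false being -, so that -s is ~~ s.    *)
(* Vertex sets live in an ambient finType T, so that a signed graph and its   *)
(* induced subgraphs have the same type.                                      *)
Record sgraph (T : finType) := SGraph {
  vset : {set T};
  edge : bool -> rel T;
  edge_sym : forall s, symmetric (edge s);
  edge_irr : forall s, irreflexive (edge s);
  edge_vset : forall s x y, edge s x y -> x \in vset;
  edge_disj : forall s x y, edge s x y -> ~~ edge (~~ s) x y
}.

Section SignedGraphs.
Variable T : finType.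
Implicit Types (G : sgraph T) (A : {set T}) (s : bool).

Section Induced.
Variables (G : sgraph T) (A : {set T}).

Definition induced_edge s : rel T :=
  fun x y => [&& x \in A, y \in A & edge G s x y].

Fact induced_sym s : symmetric (induced_edge s).
Proof. by move=> x y; rewrite /induced_edge edge_sym andbCA. Qed.

Fact induced_irr s : irreflexive (induced_edge s).
Proof. by move=> x; rewrite /induced_edge edge_irr !andbF. Qed.

Fact induced_vset s x y : induced_edge s x y -> x \in vset G :&: A.
Proof. by case/and3P=> xA _ /edge_vset xG; rewrite inE xG. Qed.

Fact induced_disj s x y : induced_edge s x y -> ~~ induced_edge (~~ s) x y.
Proof.
by case/and3P=> _ _ /edge_disj/negbTE e; rewrite /induced_edge e !andbF.
Qed.

Definition induced : sgraph T :=
  SGraph induced_sym induced_irr induced_vset induced_disj.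

End Induced.

Definition delete G (v : T) : sgraph T := induced G [set~ v].

(* A map from V to {1, ..., |V|} is represented by a function on all of T     *)
(* whose values outside V are irrelevant.                                     *)
Definition is_ordering G (nu : T -> nat) : Prop :=
  {in vset G &, injective nu} /\
  (forall i, 1 <= i <= #|vset G| <-> exists2 v, v \in vset G & nu v = i).

Definition is_SEO G (nu : T -> nat) : Prop :=
  is_ordering G nu /\
  forall u v w, u \in vset G -> v \in vset G -> w \in vset G ->
    u != v -> v != w -> u != w ->
    nu u < nu w -> nu v < nu w ->
    forall s,
      (edge G s u w -> edge G s w v -> edge G s u v) /\
      (edge G s u v -> edge G (~~ s) v w -> edge G s u w).

Definition signed_eliminable G : Prop := exists nu : T -> nat, is_SEO G nu.

Definition closed_nbh G s (v : T) : {set T} := v |: [set w | edge G s v w].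

Definition clique G s A : bool :=
  [forall x in A, forall y in A, (x != y) ==> edge G s x y].

Definition signed_simplicial G (v : T) : bool :=
  [forall s,
     clique G s (closed_nbh G s v) &&
     [forall u, forall w,
        edge G (~~ s) u w ==> edge G s w v ==> edge G (~~ s) u v]].

Definition simplicial_set G : {set T} :=
  [set v in vset G | signed_simplicial G v].

(* alg_output G out: some execution of the algorithm on G returns out, where  *)
(* None stands for NULL. It is a relation because the choice of v is free.    *)
Inductive alg_output : sgraph T -> option (seq T) -> Prop :=
| Alg_empty G : vset G = set0 -> alg_output G (Some [::])
| Alg_null G : vset G != set0 -> simplicial_set G = set0 -> alg_output G None
| Alg_step G v out : vset G != set0 -> v \in simplicial_set G ->
    alg_output (delete G v) out ->
    alg_output G (omap (fun ws => rcons ws v) out).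

End SignedGraphs.

(* Main.v *)
Require Import Defs.
From mathcomp Require Import all_boot.

(** Placing a vertex of S(G) last extends every elimination ordering of the rest
of G.  Conversely, the last vertex of an elimination ordering lies in S(G), and
the elimination conditions are inherited by induced subgraphs, so on a
signed-eliminable graph the algorithm cannot get stuck, whichever vertices it
picks. *)

Section SignedElimination.
Set Implicit Arguments.
Unset Strict Implicit.
Variable T : finType.
Implicit Types (G : sgraph T) (nu : T -> nat) (u v w : T).

(** (E1) and (E2) with [w] in the role of the latest vertex; keeping the order out lets the same
    condition express simpliciality of [w]. *)
Definition eliminable_triple G u v w : Prop :=
  forall s, (edge G s u w -> edge G s w v -> edge G s u v) /\
            (edge G s u v -> edge G (~~ s) v w -> edge G s u w).

(* is_SEO with the bijectivity of nu onto {1, ..., |V|} dropped, so that it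
   passes to induced subgraphs without renumbering. *)
Definition elimination_labelling G nu : Prop :=
  forall u v w, u \in vset G -> v \in vset G -> w \in vset G ->
    u != v -> v != w -> u != w -> nu u < nu w -> nu v < nu w ->
    eliminable_triple G u v w.

Lemma edge_neq G s u v : edge G s u v -> u != v.
Proof. by apply: contraTneq => ->; rewrite edge_irr. Qed.

Lemma edge_vsetr G s u v : edge G s u v -> v \in vset G.
Proof. by rewrite edge_sym => /edge_vset. Qed.

(** (S1) is (E1) read at the last vertex [w], and (S2) for a sign is (E2) for the opposite sign. *)
Lemma signed_simplicialP G w :
  reflect {in vset G &, forall u v, u != v -> v != w -> u != w ->
             eliminable_triple G u v w}
          (signed_simplicial G w).
Proof.
apply: (iffP forallP) => [simpl_w u v _ _ uv _ uw s | elim_w s].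
  split=> [euw ewv | euv evw].
    have /andP[/forall_inP/(_ u) cl _] := simpl_w s.
    have uN : u \in closed_nbh G s w by rewrite !inE [edge _ _ w u]edge_sym euw orbT.
    have vN : v \in closed_nbh G s w by rewrite !inE ewv orbT.
    by have /forall_inP/(_ v vN)/implyP := cl uN; apply.
  have /andP[_ /forallP/(_ u)/forallP/(_ v)] := simpl_w (~~ s).
  by rewrite negbK euv evw.
apply/andP; split.
  apply/forall_inP=> x; rewrite !inE => xN; apply/forall_inP=> y.
  rewrite !inE => yN; apply/implyP=> xy.
  case/orP: xN => [/eqP xw | ewx].
    by case/orP: yN xy => [/eqP-> | ]; rewrite xw ?eqxx.
  case/orP: yN => [/eqP-> | ewy]; first by rewrite edge_sym.
  have [xw yw] : x != w /\ y != w.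
    by rewrite ![_ == w]eq_sym (edge_neq ewx) (edge_neq ewy).
  have [+ _] := elim_w x y (edge_vsetr ewx) (edge_vsetr ewy) xy yw xw s.
  by rewrite [edge G s x w]edge_sym; apply.
apply/forallP=> u; apply/forallP=> v; apply/implyP=> euv; apply/implyP=> evw.
(* If [u] were [w], the edge [uv] would carry both signs. *)
have uw : u != w.
  by apply: contraTneq euv => ->; rewrite edge_sym; apply: edge_disj.
have [_] := elim_w u v (edge_vset euv) (edge_vsetr euv) (edge_neq euv)
              (edge_neq evw) uw (~~ s).
by rewrite negbK; apply.
Qed.

Lemma vset_delete G v : vset (delete G v) = vset G :\ v.
Proof. by rewrite /= setDE. Qed.

Lemma edge_delete G v s x y : x != v -> y != v ->
  edge (delete G v) s x y = edge G s x y.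
Proof. by move=> xv yv; rewrite /= /induced_edge !inE xv yv. Qed.

Lemma eliminable_triple_delete G z u v w : u != z -> v != z -> w != z ->
  eliminable_triple (delete G z) u v w <-> eliminable_triple G u v w.
Proof.
by move=> uz vz wz; split=> elim s; have := elim s; rewrite !edge_delete.
Qed.

Lemma elimination_labelling_delete G nu z :
  elimination_labelling G nu -> elimination_labelling (delete G z) nu.
Proof.
move=> elim u v w; rewrite vset_delete => /setD1P[uz uG] /setD1P[vz vG].
by move=> /setD1P[wz wG] *; apply/eliminable_triple_delete=> //; apply: elim.
Qed.

(** Take [w] of maximal label. Injectivity makes the maximum strict, so any two other vertices form
    with [w] a triple in which [w] comes last. *)
Lemma elimination_labelling_simplicial G nu :
  {in vset G &, injective nu} -> elimination_labelling G nu ->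
  vset G != set0 -> simplicial_set G != set0.
Proof.
move=> nu_inj elim /set0Pn[x xG]; apply/set0Pn.
case: (@arg_maxnP _ x (mem (vset G)) nu xG) => w wG w_max; exists w.
rewrite inE [w \in _]wG; apply/signed_simplicialP=> u v uG vG uv vw uw.
have lt_w y : y \in vset G -> y != w -> nu y < nu w.
  move=> yG yw; rewrite ltn_neqAle [_ <= _]w_max // andbT.
  by apply: contraNneq yw => /nu_inj->.
by apply: elim; rewrite ?lt_w.
Qed.

Lemma is_ordering_index G (vs : seq T) :
  uniq vs -> vs =i vset G -> is_ordering G (fun v => (index v vs).+1).
Proof.
move=> vs_uniq vsG; split=> [u v uG vG [] | i].
  by apply: index_inj; rewrite // vsG.
have -> : #|vset G| = size vs by rewrite -(eq_card vsG); apply/card_uniqP.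
split=> [/andP[i_gt0 i_le] | [v vG <-]]; last by rewrite index_mem vsG.
case: i i_gt0 i_le => // i _ i_lt.
(* A default for [nth]: [vs] is nonempty because it has a position [i]. *)
have x0 : T by case: vs i_lt {vs_uniq vsG}.
by exists (nth x0 vs i); rewrite -?vsG ?mem_nth ?index_uniq.
Qed.

(** Every step deletes a vertex, so the recursion terminates; claims about all outputs are therefore
    not vacuous. *)
Lemma alg_output_exists G : exists out, alg_output G out.
Proof.
have [n] := ubnP #|vset G|; elim: n G => // n IHn G le_n.
have [G0 | Gn0] := eqVneq (vset G) set0.
  by exists (Some [::]); apply: Alg_empty.
have [S0 | /set0Pn[v vS]] := eqVneq (simplicial_set G) set0.
  by exists None; apply: Alg_null.
have [|out outP] := IHn (delete G v); last first.
  by exists (omap (fun ws => rcons ws v) out); apply: Alg_step.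
have vG : v \in vset G by move: vS; rewrite inE => /andP[].
by rewrite vset_delete; move: le_n; rewrite (cardsD1 v) vG.
Qed.

(** The same [nu] serves after each deletion, even if the chosen vertex is not the last one for
    [nu]; so a simplicial vertex is available at every stage. *)
Lemma alg_output_labelling G out nu : alg_output G out ->
  {in vset G &, injective nu} -> elimination_labelling G nu -> out <> None.
Proof.
move=> outP; elim: outP nu => {G out} // [G Gn0 S0 | G v out _ _ _ IH] nu inj elim.
  by have := elimination_labelling_simplicial inj elim Gn0; rewrite S0 eqxx.
have /IH : {in vset (delete G v) &, injective nu}.
  by move=> x y; rewrite vset_delete => /setD1P[_ xG] /setD1P[_ yG]; apply: inj.
by move=> /(_ (elimination_labelling_delete elim)); case: out {IH}.
Qed.

(** A triple ending at [z] is handled by simpliciality; any other triple avoids [z], which has the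
    largest label, and so lies in [delete G z]. *)
Lemma elimination_labelling_rcons G z (ws : seq T) :
  ws =i vset (delete G z) -> signed_simplicial G z ->
  elimination_labelling (delete G z) (fun v => (index v ws).+1) ->
  elimination_labelling G (fun v => (index v (rcons ws z)).+1).
Proof.
move=> wsG /signed_simplicialP simpl_z elim u v w uG vG wG uv vw uw.
have [wz | wz] := eqVneq w z.
  by rewrite wz in vw uw *; move=> _ _; apply: simpl_z.
have mem_ws y : y \in vset G -> (y \in ws) = (y != z).
  by move=> yG; rewrite wsG vset_delete !inE yG andbT.
have w_lt : index w ws < size ws by rewrite index_mem mem_ws.
have z_ge : size ws <= index z (rcons ws z).
  by rewrite -cats1 index_cat wsG vset_delete !inE eqxx leq_addr.
have idx y : y \in vset G -> y != z -> index y (rcons ws z) = index y ws.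
  by move=> yG yz; rewrite -cats1 index_cat mem_ws ?yz.
rewrite (idx w) // !ltnS.
have [-> | uz] := eqVneq u z; first by move/(leq_ltn_trans z_ge); rewrite ltnNge ltnW.
have [-> | vz] := eqVneq v z.
  by move=> _ /(leq_ltn_trans z_ge); rewrite ltnNge ltnW.
rewrite !idx // => lt_uw lt_vw; apply/(eliminable_triple_delete G uz vz wz).
by apply: elim; rewrite // vset_delete !inE ?uz ?vz ?wz.
Qed.

Lemma alg_output_SEO G out vs : alg_output G out -> out = Some vs ->
  [/\ uniq vs, vs =i vset G
    & elimination_labelling G (fun v => (index v vs).+1)].
Proof.
move=> outP; elim: outP vs => {G out} [G G0 | // | G z [ws|] _ zS _ IH] vs // [<-].
  by split=> // x; rewrite G0 !inE.
have [ws_uniq wsG elim] := IH _ (erefl _).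
have [zG simpl_z] : z \in vset G /\ signed_simplicial G z.
  by apply/andP; rewrite inE in zS.
split; last exact: elimination_labelling_rcons.
  by rewrite rcons_uniq ws_uniq wsG vset_delete !inE eqxx.
move=> x; rewrite mem_rcons inE wsG vset_delete !inE.
by have [-> | ] := eqVneq x z; rewrite ?zG.
Qed.

End SignedElimination.

Theorem theorem3p13 (T : finType) (G : sgraph T) :
  (exists out : option (seq T), alg_output G out) /\
  (forall out : option (seq T), alg_output G out ->
     (signed_eliminable G <-> exists vs : seq T, out = Some vs) /\
     (forall vs : seq T, out = Some vs ->
        [/\ uniq vs, vs =i vset G
          & is_SEO G (fun v => (index v vs).+1)])).
Proof.
split=> [|out outP]; first exact: alg_output_exists.
have seoP vs : out = Some vs ->
    [/\ uniq vs, vs =i vset G & is_SEO G (fun v => (index v vs).+1)].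
  move=> /(alg_output_SEO outP)[vs_uniq vsG elim]; split=> //.
  by split; first exact: is_ordering_index.
split=> //; split=> [[nu [[inj _] elim]] | [vs /seoP[_ _ seo]]].
  (* An ordering is injective, so its elimination property rules out NULL. *)
  case: out outP {seoP} => [vs _ | outP]; first by exists vs.
  by have := alg_output_labelling outP inj elim.
by exists (fun v => (index v vs).+1).
Qed.
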